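(* There exists a constant $c>0$ such that the following holds. Let $P$ be the transition matrix of an irreducible, reversible and transitive Markov chain on a finite state space $\Omega$ with at least two states, with stationary distribution $\pi$. Let $0\le\lambda_Y\le 1$ and $0\le\lambda_Z<\infty$, and let $X,Y,Z$ be independent continuous-time Markov chains with transition matrix $P$ and speeds $\lambda_X=1$, $\lambda_Y$, $\lambda_Z$ respectively, with $X_0,Y_0,Z_0$ independent with law $\pi$. Define \[M^{\rm good}=\inf\{t\ge0:X_t=Y_t\},\qquad M^{\rm bad}=\inf\{t\ge0:X_t=Z_t\}\wedge\inf\{t\ge0:Y_t=Z_t\}.\] Then \[\mathbb P\big(M^{\rm good}<M^{\rm bad}\big)\ge \frac{c}{\big(\sqrt{1+\lambda_Z}+\sqrt{\lambda_Y+\lambda_Z}\big)^2}.\]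
   Context: A continuous-time Markov chain $W$ has speed $\lambda_W$ and transition matrix $P$ if it jumps at rate $\lambda_W$ according to $P$, i.e. has generator $\lambda_W(P-I)$ (speed $0$ means it stays put). An automorphism of $P$ is a bijection $\phi:\Omega\to\Omega$ with $P(z,w)=P(\phi(z),\phi(w))$ for all $z,w$; $P$ is transitive if for all $x,y\in\Omega$ there is an automorphism $\phi$ with $\phi(x)=y$. *)

(* Defs.v *)
From HB Require Import structures.
From mathcomp Require Import all_boot all_order all_algebra.
From mathcomp Require Import all_classical all_reals all_analysis.
Set Implicit Arguments. Unset Strict Implicit. Unset Printing Implicit Defensive.
Import Order.TTheory GRing.Theory Num.Theory.
Local Open Scope classical_set_scope.
Local Open Scope ring_scope.

Section Chains.
Variables (R : realType) (S : finType).

Fixpoint mpow (P : S -> S -> R) (k : nat) : S -> S -> R :=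
  match k with
  | O => fun x y => if x == y then 1 else 0
  | k'.+1 => fun x y => \sum_(z : S) mpow P k' x z * P z y
  end.

Definition stochastic (P : S -> S -> R) :=
  (forall x y, 0 <= P x y) /\ (forall x, \sum_(y : S) P x y = 1).

Definition irreducible (P : S -> S -> R) :=
  forall x y, exists n, 0 < mpow P n x y.

Definition stationary (P : S -> S -> R) (pi : S -> R) :=
  (forall x, 0 <= pi x) /\ \sum_(x : S) pi x = 1 /\
  (forall y, \sum_(x : S) pi x * P x y = pi y).

Definition reversible (P : S -> S -> R) (pi : S -> R) :=
  forall x y, pi x * P x y = pi y * P y x.

Definition automorphism (P : S -> S -> R) (phi : S -> S) :=
  bijective phi /\ forall z w, P z w = P (phi z) (phi w).

Definition transitive_chain (P : S -> S -> R) :=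
  forall x y, exists phi, automorphism P phi /\ phi x = y.

(* transition kernel at time t of the chain with speed lam and matrix P,
   i.e. exp(t * lam * (P - I)) (x, y), written as its (Poisson) series
   sum_k e^{-lam t} (lam t)^k / k! P^k(x,y). *)
Definition heat (P : S -> S -> R) (lam t : R) (x y : S) : R :=
  fine (\sum_(k <oo) ((expR (- (lam * t)) * (lam * t) ^+ k / (k`!)%:R
                       * mpow P k x y)%:E))%E.

Definition path_prob (P : S -> S -> R) (pi : S -> R) (lam : R) (n : nat)
  (ts : nat -> R) (xs : nat -> S) : R :=
  pi (xs 0%N) * \prod_(i < n) heat P lam (ts i.+1 - ts i) (xs i) (xs i.+1).

Definition right_cont_path (w : R -> S) :=
  forall t, 0 <= t -> exists2 e : R, 0 < e &
    forall s, t <= s -> s < t + e -> w s = w t.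

Definition meet_time (a b : R -> S) : \bar R :=
  ereal_inf [set (t%:E)%E | t in [set t : R | 0 <= t /\ a t = b t]].

End Chains.

(* Main.v *)
(* Let h(x, z) be the expected hitting time of z from x at unit speed and t its
   mean over x; h is symmetric by reversibility and transitivity, and h <= 2 t.
   The function phi(x, y, z) = h(x, z) + h(y, z) - h(x, y) vanishes on the bad
   set {x = z or y = z}, and away from the diagonals the generator maps it to
   the constant -2 lamZ.  Let f be the expected time to reach the bad set.
   Superadditivity of conductances in the three speeds bounds the mean of f by
   t / D with D = 1 + lamY + 2 lamZ, so

     psi = (phi - (2 lamZ + 1/2) f) / (4 t)

   is 0 on the bad set, at most 1 on {x = y}, strictly subharmonic elsewhere, and
   has mean at least (1/8) / D under the uniform law; this mean is thus a lower
   bound for the probability of a good meeting before a bad one.  Finally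
   D is at most the square of sqrt (1 + lamZ) + sqrt (lamY + lamZ).

   The subharmonicity of psi is strict, hence survives the O(dt^2) error of
   sampling the chains at multiples of a small dt, where finite-dimensional laws
   suffice; by right-continuity the event of the theorem is the limit superior
   of its sampled versions. *)
Require Import Defs.
From HB Require Import structures.
From mathcomp Require Import all_boot all_order all_algebra.
From mathcomp Require Import all_classical all_reals all_analysis.
From mathcomp Require Import ring lra.
Set Implicit Arguments. Unset Strict Implicit. Unset Printing Implicit Defensive.
Import Order.TTheory GRing.Theory Num.Theory.
Local Open Scope classical_set_scope.
Local Open Scope ring_scope.

(** * Linear algebra on functions over a finite set *)

Lemma linear_solvable (F : fieldType) (T : finType) (L : (T -> F) -> T -> F) :
  (forall a b u v x, L (fun y => a * u y + b * v y) x = a * L u x + b * L v x) ->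
  (forall u, (forall x, L u x = 0) -> forall x, u x = 0) ->
  forall b : T -> F, exists u, forall x, L u x = b x.
Proof.
move=> Llin Linj b.
pose A x y := L (fun z => (z == y)%:R) x.
have L_sum (r : seq T) (u : T -> F) x :
    L (fun z => \sum_(y <- r) (z == y)%:R * u y) x = \sum_(y <- r) A x y * u y.
  have L0 : L (fun=> 0) x = 0.
    by have := Llin 0 0 (fun=> 0) (fun=> 0) x; rewrite !mul0r addr0.
  elim: r => [|y r IH].
    rewrite big_nil -[RHS]L0; congr (L _ x); apply/funext => z.
    by rewrite big_nil.
  rewrite big_cons -IH mulrC -[X in _ + X]mul1r -Llin; congr (L _ x).
  by apply/funext => z; rewrite big_cons mul1r mulrC.
have LE u x : L u x = \sum_y A x y * u y.
  rewrite -L_sum; congr (L _ x); apply/funext => z.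
  rewrite (bigD1 z) //= eqxx mul1r big1 ?addr0 // => y /negbTE.
  by rewrite eq_sym => ->; rewrite mul0r.
(* Row vectors act from the left, hence the transposed indices: [v *m M] represents [L] applied to
   the function coded by [v]. Injectivity of [L] makes the kernel of [M] trivial, so [M] is
   invertible. *)
pose M : 'M[F]_#|T| := \matrix_(i, j) A (enum_val j) (enum_val i).
have rowE (v : 'rV[F]_#|T|) j :
    (v *m M) 0 j = L (fun y => v 0 (enum_rank y)) (enum_val j).
  rewrite LE mxE (reindex (@enum_rank T)) /=; last exact: onW_bij (@enum_rank_bij T).
  by apply: eq_bigr => y _; rewrite !mxE enum_rankK mulrC.
have Munit : M \in unitmx.
  rewrite -row_free_unit -kermx_eq0; apply/rowV0P => v /sub_kermxP vM0.
  apply/rowP => i; rewrite mxE -[i]enum_valK.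
  apply: (Linj (fun y => v 0 (enum_rank y))) => x.
  by rewrite -[x]enum_rankK -rowE vM0 mxE.
pose v : 'rV[F]_#|T| := (\row_i b (enum_val i)) *m invmx M.
exists (fun y => v 0 (enum_rank y)) => x.
by rewrite -[x]enum_rankK -rowE /v mulmxKV // mxE enum_rankK.
Qed.

(** * Dirichlet forms *)

Section Laplacian.
Variables (R : realType) (S : finType) (P : S -> S -> R).
Hypothesis P_stoch : stochastic P.
Hypothesis P_sym : forall x y, P x y = P y x.
Implicit Types u v : S -> R.

(** This is [I - P], minus the generator at unit speed; the sign makes its quadratic form
    nonnegative. *)
Definition lap u x : R := u x - \sum_y P x y * u y.

Lemma lapE u x : lap u x = \sum_y P x y * (u x - u y).
Proof.
rewrite /lap -[in LHS](mul1r (u x)) -(P_stoch.2 x) mulr_suml -sumrB.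
by apply: eq_bigr => y _; rewrite mulrBr.
Qed.

Lemma lap_lin a b u v x :
  lap (fun y => a * u y + b * v y) x = a * lap u x + b * lap v x.
Proof.
rewrite !lapE !mulr_sumr -big_split; apply: eq_bigr => y _ /=; ring.
Qed.

Lemma lap_cst a x : lap (fun=> a) x = 0.
Proof. by rewrite lapE big1 // => y _; rewrite subrr mulr0. Qed.

(** By symmetry of [P], each edge can be read in both directions; averaging the two readings gives
    the form. *)
Lemma dirichletE u v :
  \sum_x u x * lap v x = 2^-1 * \sum_x \sum_y P x y * ((u x - u y) * (v x - v y)).
Proof.
have e1 : \sum_x u x * lap v x = \sum_x \sum_y P x y * (u x * (v x - v y)).
  apply: eq_bigr => x _; rewrite lapE mulr_sumr; apply: eq_bigr => y _; ring.
have e2 : \sum_x u x * lap v x = \sum_x \sum_y P x y * (u y * (v y - v x)).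
  rewrite e1 exchange_big; apply: eq_bigr => x _; apply: eq_bigr => y _.
  by rewrite P_sym.
rewrite -[LHS](@mulKf _ 2) ?pnatr_eq0 //; congr (_ * _).
rewrite mulr_natl mulr2n {1}e1 e2 -big_split; apply: eq_bigr => x _ /=.
rewrite -big_split; apply: eq_bigr => y _ /=; ring.
Qed.

Lemma dirichletC u v : \sum_x u x * lap v x = \sum_x v x * lap u x.
Proof.
rewrite !dirichletE; congr (_ * _); apply: eq_bigr => x _.
by apply: eq_bigr => y _; rewrite [in RHS](mulrC (v x - _)).
Qed.

Lemma dirichlet_ge0 u : 0 <= \sum_x u x * lap u x.
Proof.
rewrite dirichletE mulr_ge0 ?invr_ge0 ?ler0n // sumr_ge0 // => x _.
by rewrite sumr_ge0 // => y _; rewrite mulr_ge0 ?P_stoch.1 // -expr2 sqr_ge0.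
Qed.

(** The energy of [u - s v] is nonnegative. With [v] a test function of known Laplacian, this bounds
    the energy of [u] below by a linear functional of [u]. *)
Lemma dirichlet_ge (s : R) u v :
  2 * s * (\sum_x u x * lap v x) - s ^+ 2 * (\sum_x v x * lap v x) <=
  \sum_x u x * lap u x.
Proof.
have := dirichlet_ge0 (fun x => 1 * u x + (- s) * v x).
have -> : \sum_x (1 * u x + - s * v x) * lap (fun y => 1 * u y + - s * v y) x =
   \sum_x u x * lap u x - s * (\sum_x u x * lap v x)
   - s * (\sum_x v x * lap u x) + s ^+ 2 * (\sum_x v x * lap v x).
  rewrite !mulr_sumr -!sumrB -big_split; apply: eq_bigr => x _ /=.
  rewrite lap_lin; ring.
rewrite (dirichletC v u); lra.
Qed.

(** The inequality holds edge by edge, because the negative part is a monotone 1-Lipschitz function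
    of [- u]. It yields the minimum principle for the exit time. *)
Lemma dirichlet_neg u :
  \sum_x Num.max (- u x) 0 * lap (fun y => Num.max (- u y) 0) x <=
  - \sum_x Num.max (- u x) 0 * lap u x.
Proof.
rewrite !dirichletE -mulrN ler_pM2l ?invr_gt0 ?ltr0n // -sumrN.
apply: ler_sum => x _; rewrite -sumrN; apply: ler_sum => y _.
rewrite -mulrN ler_wpM2l ?P_stoch.1 // -mulrN.
have [x0|x0] := lerP 0 (- u x); have [y0|y0] := lerP 0 (- u y); nra.
Qed.

Hypothesis P_irr : irreducible P.

Lemma irreducible_closed (A : S -> Prop) x :
  A x -> (forall y z, A y -> 0 < P y z -> A z) -> forall y, A y.
Proof.
move=> Ax Astep y; have [k] := P_irr x y.
elim: k y => [|k IH] y /=; first by case: eqP => [<-//|_]; rewrite ltxx.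
move=> kgt0.
have [z] : exists z, 0 < mpow P k x z * P z y.
  apply/existsP; apply: contraLR kgt0 => /existsPn noz.
  by rewrite -leNgt sumr_le0 // => z _; rewrite leNgt; have := noz z.
move=> zgt0.
have Pzy : 0 < P z y.
  rewrite lt_def (P_stoch.1) andbT; apply: contraTneq zgt0 => ->.
  by rewrite mulr0 ltxx.
by apply: (Astep z) => //; apply: IH; rewrite -(pmulr_lgt0 _ Pzy).
Qed.

(** All edge terms are nonnegative, so each vanishes; [u] is then constant along edges of positive
    probability, which connect everything. *)
Lemma dirichlet0_cst u :
  \sum_x u x * lap u x <= 0 -> forall x y, u x = u y.
Proof.
rewrite dirichletE pmulr_rle0 ?invr_gt0 ?ltr0n // => le0 x.
have ge0 a b : 0 <= P a b * ((u a - u b) * (u a - u b)).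
  by rewrite mulr_ge0 ?P_stoch.1 // -expr2 sqr_ge0.
have /eqP : \sum_x \sum_y P x y * ((u x - u y) * (u x - u y)) == 0.
  by rewrite eq_le le0 sumr_ge0 // => a _; rewrite sumr_ge0.
move=> sum0.
have step a b : P a b * ((u a - u b) * (u a - u b)) = 0.
  have /psumr_eq0P := sum0 => /(_ (fun c _ => sumr_ge0 _ (fun d _ => ge0 c d))).
  by move=> /(_ a isT) /psumr_eq0P => /(_ (fun d _ => ge0 a d)) /(_ b isT).
apply: (irreducible_closed (x := x)) => // y z -> Pyz.
have /eqP := step y z.
by rewrite mulf_eq0 gt_eqF //= mulf_eq0 orbb subr_eq0 => /eqP.
Qed.

End Laplacian.

(** * Uniformity of the stationary law and symmetry of the matrix *)

Section Uniform.
Variables (R : realType) (S : finType) (P : S -> S -> R) (pi : S -> R).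
Hypotheses (P_stoch : stochastic P) (P_irr : irreducible P).
Hypotheses (pi_stat : stationary P pi) (P_rev : reversible P pi).
Hypothesis P_trans : transitive_chain P.

(** An automorphism carries one column onto another, so all column sums agree; their total is the
    total of the row sums. *)
Lemma transitive_column_sum y : \sum_x P x y = 1.
Proof.
have colE z w : \sum_x P x z = \sum_x P x w.
  have [phi [[phi_bij phiP] <-]] := P_trans z w.
  rewrite [RHS](reindex phi) /=; last exact: onW_bij.
  by apply: eq_bigr => x _.
have : \sum_z \sum_x P x z = #|S|%:R :> R.
  rewrite exchange_big /= (eq_bigr (fun=> 1)) ?sumr_const // => x _.
  exact: P_stoch.2.
rewrite (eq_bigr (fun=> \sum_x P x y)) => [|z _]; last exact: colE.
have n0 : #|S|%:R != 0 :> R by rewrite pnatr_eq0 -lt0n; apply/card_gt0P; exists y.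
rewrite sumr_const -[X in X = _]mulr_natr -[X in _ = X]mul1r => /(mulIf n0); exact.
Qed.

(** Maximum principle: columns sum to 1, so stationarity makes [pi a] an average of [pi] over the
    predecessors of [a], and a maximal value spreads to all of them. *)
Lemma stationary_uniform x : pi x = #|S|%:R^-1.
Proof.
have [pi_ge0 [pi_sum pi_inv]] := pi_stat.
have [m _ m_max'] := @arg_maxP _ _ _ x xpredT pi isT.
have m_max y : pi y <= pi m by exact: m_max'.
have pim_gt0 : 0 < pi m.
  rewrite lt_neqAle pi_ge0 andbT; apply/eqP => pim0.
  have : \sum_(x : S) pi x <= 0 by apply: sumr_le0 => y _; rewrite pim0 m_max.
  by rewrite pi_sum ler10.
have pi_m y : pi y = pi m.
  apply: (irreducible_closed P_stoch P_irr (A := fun y => pi y = pi m) (x := m)) => // a b pia Pab.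
  (* Reversibility makes the successor [b] of [a] also a predecessor, as the averaging argument
     requires. *)
  have Pba : P b a != 0.
    apply: contraTneq (mulr_gt0 pim_gt0 Pab) => Pba0.
    by rewrite -pia P_rev Pba0 mulr0 ltxx.
  have /psumr_eq0P : \sum_c (pi m - pi c) * P c a = 0.
    under eq_bigr do rewrite mulrBl.
    by rewrite sumrB -mulr_sumr transitive_column_sum pi_inv pia mulr1 subrr.
  have ge0 c : 0 <= (pi m - pi c) * P c a.
    by rewrite mulr_ge0 ?P_stoch.1 ?subr_ge0 ?m_max.
  move=> /(_ (fun c _ => ge0 c)) /(_ b isT) /eqP.
  by rewrite mulf_eq0 (negbTE Pba) orbF subr_eq0 => /eqP.
have := pi_sum; under eq_bigr do rewrite pi_m -(pi_m x).
have n0 : #|S|%:R != 0 :> R by rewrite pnatr_eq0 -lt0n; apply/card_gt0P; exists x.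
by rewrite sumr_const -[pi x *+ _]mulr_natr => /(canRL (mulfK n0)); rewrite mul1r.
Qed.

Lemma transitive_symmetric x y : P x y = P y x.
Proof.
have := P_rev x y; rewrite !stationary_uniform; apply: mulfI.
by rewrite invr_eq0 pnatr_eq0 -lt0n; apply/card_gt0P; exists x.
Qed.

End Uniform.

(** * Hitting times *)

Section HittingTime.
Variables (R : realType) (S : finType) (P : S -> S -> R).
Hypotheses (P_stoch : stochastic P) (P_irr : irreducible P).
Hypothesis P_sym : forall x y, P x y = P y x.

Lemma sum_lap u : \sum_x lap P u x = 0.
Proof.
transitivity (\sum_x 1 * lap P u x); first by apply: eq_bigr => x _; rewrite mul1r.
rewrite (dirichletC P_stoch P_sym (fun=> 1)) big1 // => x _.
by rewrite (lap_cst P_stoch) mulr0.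
Qed.

Lemma lap_injective u :
  (forall x, lap P u x = 0) -> \sum_x u x = 0 -> forall x, u x = 0.
Proof.
move=> lapu0 sumu0 x.
have ucst : forall y z, u y = u z.
  apply: (dirichlet0_cst P_stoch P_sym P_irr).
  by rewrite big1 // => y _; rewrite lapu0 mulr0.
have := sumu0; rewrite (eq_bigr (fun=> u x)) => [|y _]; last exact: ucst.
rewrite sumr_const => /eqP; rewrite mulrn_eq0 => /orP[/eqP c0|/eqP //].
by have := max_card (pred1 x); rewrite c0 card1.
Qed.

(** [G z] solves the Poisson equation with a unit source at [z], balanced by a uniform sink, since
    the image of [lap] has mean zero. *)
Lemma green_function : exists G : S -> S -> R,
  (forall z, \sum_x G z x = 1) /\
  (forall z x, lap P (G z) x = (x == z)%:R - #|S|%:R^-1).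
Proof.
have [x0 _|S0] := @pickP S xpredT; last by exists (fun _ _ => 0); split=> z; have := S0 z.
have n0 : #|S|%:R != 0 :> R by rewrite pnatr_eq0 -lt0n; apply/card_gt0P; exists x0.
(* The added mean term removes the kernel of [lap], the constants. Summation shows that [L]
   preserves total mass, so [G z] has mass 1 and the extra term is the constant [1/n]. *)
pose L u x := lap P u x + #|S|%:R^-1 * \sum_y u y.
have L_lin a b u v x : L (fun y => a * u y + b * v y) x = a * L u x + b * L v x.
  by rewrite /L (lap_lin P_stoch) big_split /= -!mulr_sumr; ring.
have sumL u : \sum_x L u x = \sum_y u y.
  by rewrite big_split /= sum_lap add0r sumr_const -[X in X = _]mulr_natl mulVKf.
have /fin_all_exists [G GE] (z : S) :
    exists u : S -> R, forall x, L u x = (x == z)%:R.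
  apply: linear_solvable => // u Lu0.
  have sumu0 : \sum_y u y = 0 by rewrite -sumL big1.
  apply: lap_injective => // x.
  by have := Lu0 x; rewrite /L sumu0 mulr0 addr0.
have sumG z : \sum_x G z x = 1.
  rewrite -sumL (eq_bigr (fun x => (x == z)%:R)) => [|x _]; last exact: GE.
  by rewrite (bigD1 z) //= eqxx big1 ?addr0 // => x /negbTE ->.
exists G; split=> // z x.
by rewrite -GE /L sumG mulr1 addrK.
Qed.

Hypothesis P_trans : transitive_chain P.
Hypothesis S_gt1 : (1 < #|S|)%N.

(* [h x z] is the expected hitting time of [z] from [x], and [t] its mean when
   [x] is uniform. *)
Lemma hitting_time : exists (h : S -> S -> R) (t : R),
  [/\ 0 < t, forall x, h x x = 0, forall x z, h x z = h z x &
   [/\ forall x z, h x z <= 2 * t, forall z, \sum_x h x z = #|S|%:R * t &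
       forall x z, lap P (h^~ z) x = 1 - (x == z)%:R * #|S|%:R]].
Proof.
have [G [sumG lapG]] := green_function.
pose n : R := #|S|%:R.
have n_gt1 : 1 < n by rewrite ltr1n.
have n0 : n != 0 by rewrite gt_eqF // (lt_trans ltr01).
have sum_lapG u z : \sum_x u x * lap P (G z) x = u z - n^-1 * \sum_x u x.
  under eq_bigr do rewrite lapG mulrBr.
  rewrite sumrB (bigD1 z) //= eqxx mulr1 big1 ?addr0 => [|x /negbTE ->]; last by rewrite mulr0.
  by rewrite -mulr_suml mulrC.
have Gsym x z : G x z = G z x.
  apply: (addIr (- n^-1)).
  by have := dirichletC P_stoch P_sym (G x) (G z); rewrite !sum_lapG !sumG !mulr1.
have [x0 _] : exists x : S, x \in S by apply/card_gt0P; exact: ltnW.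
pose g := G x0 x0.
(* Transporting [G (phi x0)] by the automorphism gives a function with the same Laplacian and the
   same mass as [G x0], hence equal to it. *)
have Gdiag x : G x x = g.
  have [phi [[phi_bij phiP] <-]] := P_trans x0 x.
  have sum_phi (F : S -> R) : \sum_y F y = \sum_y F (phi y).
    by rewrite (reindex phi) //; exact: onW_bij.
  suff : 1 * G (phi x0) (phi x0) + (-1) * G x0 x0 = 0 by rewrite /g; lra.
  apply: (lap_injective (u := fun y => 1 * G (phi x0) (phi y) + (-1) * G x0 y)).
    move=> y; rewrite (lap_lin P_stoch) lapG.
    have -> : lap P (fun z => G (phi x0) (phi z)) y = lap P (G (phi x0)) (phi y).
      rewrite /lap [in RHS]sum_phi; congr (_ - _); apply: eq_bigr => z _.
      by rewrite -phiP.
    by rewrite lapG (inj_eq (bij_inj phi_bij)); ring.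
  by rewrite big_split /= -!mulr_sumr -(sum_phi (G (phi x0))) !sumG; ring.
(* The factor [n] and the shift by [g] are forced by Laplacian 1 off the diagonal and value 0 on it;
   averaging over [x] then gives [n g - 1]. *)
pose h x z := n * (g - G x z); pose t := n * g - 1.
have h_diag x : h x x = 0 by rewrite /h Gdiag subrr mulr0.
have h_le x z : h x z <= 2 * t.
  (* The energy of [G x + G z] equals [2 g + 2 G x z - 4/n]; its nonnegativity is the bound. *)
  have := dirichlet_ge0 P_stoch P_sym (fun y => 1 * G x y + 1 * G z y).
  under eq_bigr do rewrite (lap_lin P_stoch) !mul1r mulrDr.
  rewrite big_split /= !sum_lapG big_split /= !sumG !Gdiag (Gsym z x).
  rewrite -(pmulr_rge0 _ (lt_trans ltr01 n_gt1)) /h /t.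
  have := mulfV n0; nra.
have h_sum z : \sum_x h x z = n * t.
  rewrite -mulr_sumr sumrB sumr_const -[g *+ _]mulr_natl.
  rewrite (eq_bigr (fun x => G z x)) ?sumG // => x _; exact: Gsym.
have h_lap x z : lap P (h^~ z) x = 1 - (x == z)%:R * n.
  have -> : h^~ z = (fun x => 1 * (n * g) + (- n) * G z x).
    by apply/boolp.funext => y; rewrite /h Gsym; ring.
  rewrite (lap_lin P_stoch) (lap_cst P_stoch (n * g)) lapG -/n.
  by rewrite mulr0 add0r -(divff n0); ring.
exists h, t; split=> // [|x z]; last by rewrite /h Gsym.
have t_ge0 : 0 <= t by have := h_le x0 x0; rewrite h_diag; lra.
(* If [t] were 0, the column of [x0] would be nonpositive with sum 0, hence zero; but its Laplacian
   at [x0] is [1 - n], which is nonzero. *)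
rewrite lt_neqAle t_ge0 andbT; apply/eqP => t0.
have h0 x : h x x0 = 0.
  have /eqP := h_sum x0; rewrite -t0 mulr0 -oppr_eq0 -sumrN => /eqP /psumr_eq0P.
  have h_le0 y : 0 <= - h y x0 by rewrite oppr_ge0 (le_trans (h_le _ _)) // -t0 mulr0.
  by move=> /(_ (fun y _ => h_le0 y)) /(_ x isT) /eqP; rewrite oppr_eq0 => /eqP.
have := h_lap x0 x0.
rewrite (_ : h^~ x0 = fun=> 0) ?(lap_cst P_stoch); last exact: boolp.funext.
rewrite eqxx mul1r => /eqP.
by rewrite eq_sym subr_eq0 lt_eqF.
Qed.

End HittingTime.

(** * The triple of walkers *)

Section TripleWalk.
Variables (R : realType) (S : finType) (P : S -> S -> R) (lamY lamZ : R).
Hypotheses (P_stoch : stochastic P) (P_irr : irreducible P).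
Hypothesis P_sym : forall x y, P x y = P y x.
Hypotheses (lamY_ge0 : 0 <= lamY) (lamZ_ge0 : 0 <= lamZ).
Implicit Types f u v : S -> S -> S -> R.

(* Minus the generator of the triple [(X, Y, Z)]. *)
Definition lap3 f x y z : R :=
  lap P (fun x' => f x' y z) x + lamY * lap P (fun y' => f x y' z) y +
  lamZ * lap P (f x y) z.

Definition bad (x y z : S) := (x == z) || (y == z).

Lemma lap3_lin a b u v x y z :
  lap3 (fun x y z => a * u x y z + b * v x y z) x y z =
  a * lap3 u x y z + b * lap3 v x y z.
Proof. by rewrite /lap3 !(lap_lin P_stoch); ring. Qed.

Lemma sum_lap3 u v :
  \sum_x \sum_y \sum_z u x y z * lap3 v x y z =
  \sum_y \sum_z \sum_x u x y z * lap P (fun x' => v x' y z) x +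
  lamY * (\sum_x \sum_z \sum_y u x y z * lap P (fun y' => v x y' z) y) +
  lamZ * (\sum_x \sum_y \sum_z u x y z * lap P (v x y) z).
Proof.
have -> : \sum_y \sum_z \sum_x u x y z * lap P (fun x' => v x' y z) x =
    \sum_x \sum_y \sum_z u x y z * lap P (fun x' => v x' y z) x.
  rewrite [RHS]exchange_big; apply: eq_bigr => y _; exact: exchange_big.
have -> : \sum_x \sum_z \sum_y u x y z * lap P (fun y' => v x y' z) y =
    \sum_x \sum_y \sum_z u x y z * lap P (fun y' => v x y' z) y.
  by apply: eq_bigr => x _; exact: exchange_big.
rewrite !mulr_sumr -!big_split; apply: eq_bigr => x _ /=.
rewrite !mulr_sumr -!big_split; apply: eq_bigr => y _ /=.
rewrite !mulr_sumr -!big_split; apply: eq_bigr => z _ /=.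
by rewrite /lap3; ring.
Qed.

(** The first walker has speed 1, so zero energy makes [u] constant in [x]; moving [x] to [z] lands
    in the bad set. *)
Lemma lap3_energy0 u : (forall x y z, bad x y z -> u x y z = 0) ->
  \sum_x \sum_y \sum_z u x y z * lap3 u x y z <= 0 -> forall x y z, u x y z = 0.
Proof.
move=> u_bad; rewrite sum_lap3 => le0 x y z.
have ge0 (v : S -> R) : 0 <= \sum_x v x * lap P v x by exact: dirichlet_ge0.
have sumX_le0 :
    \sum_y \sum_z \sum_x u x y z * lap P (fun x' => u x' y z) x <= 0.
  apply: le_trans _ le0; rewrite -addrA lerDl addr_ge0 // mulr_ge0 //;
    by apply: sumr_ge0 => ? _; apply: sumr_ge0 => ? _; exact: ge0.
have X_le0 : \sum_x u x y z * lap P (fun x' => u x' y z) x <= 0.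
  apply: le_trans _ sumX_le0; rewrite [leRHS](bigD1 y) //= [X in _ <= X + _](bigD1 z) //= -addrA lerDl.
  rewrite addr_ge0 //; first by apply: sumr_ge0 => ? _; exact: ge0.
  by apply: sumr_ge0 => ? _; apply: sumr_ge0 => ? _; exact: ge0.
rewrite (dirichlet0_cst P_stoch P_sym P_irr X_le0 x z).
by rewrite u_bad // /bad eqxx.
Qed.

(* [f x y z] is the expected time at which [(X, Y, Z)], started from
   [(x, y, z)], first has [X = Z] or [Y = Z]. *)
Lemma exit_time : exists f : S -> S -> S -> R,
  [/\ forall x y z, bad x y z -> f x y z = 0,
      forall x y z, ~~ bad x y z -> lap3 f x y z = 1 &
      forall x y z, 0 <= f x y z].
Proof.
(* Dirichlet problem: the operator is the identity on the bad set, encoding the boundary value 0,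
   and [lap3] elsewhere. *)
pose L (w : S * S * S -> R) p := let: (x, y, z) := p in
  if bad x y z then w p else lap3 (fun x y z => w (x, y, z)) x y z.
have [|w Lw0 [[x y] z]|w wE] := @linear_solvable _ _ L _ _
    (fun p => (~~ bad p.1.1 p.1.2 p.2)%:R).
- by move=> a b u v [[x y] z]; rewrite /L; case: ifP => // _; rewrite lap3_lin.
- have w_bad a b c : bad a b c -> w (a, b, c) = 0.
    by move=> abc; have := Lw0 (a, b, c); rewrite /L abc.
  apply: (lap3_energy0 (u := fun x y z => w (x, y, z))) => //.
  rewrite big1 // => a _; rewrite big1 // => b _; rewrite big1 // => c _.
  have := Lw0 (a, b, c); rewrite /L; case: ifPn => [/w_bad ->|_ ->].
    by rewrite mul0r.
  by rewrite mulr0.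
pose f x y z := w (x, y, z).
have f_bad x y z : bad x y z -> f x y z = 0.
  by move=> xyz; have := wE (x, y, z); rewrite /L xyz.
have f_lap x y z : ~~ bad x y z -> lap3 f x y z = 1.
  by move=> xyz; have := wE (x, y, z); rewrite /L /= (negbTE xyz).
exists f; split=> // x y z.
(* The negative part vanishes on the bad set, and its energy is at most minus its pairing with
   [lap3 f], hence at most 0; so it is zero. *)
pose g x y z := Num.max (- f x y z) 0.
have g0 : g x y z = 0.
  apply: lap3_energy0 => [a b c /f_bad|].
    by rewrite /g => ->; rewrite oppr0 maxxx.
  apply: (@le_trans _ _ (- \sum_x \sum_y \sum_z g x y z * lap3 f x y z)).
    rewrite !sum_lap3 !opprD -!mulrN; apply: lerD; first apply: lerD.
    - rewrite -sumrN ler_sum // => b _; rewrite -sumrN ler_sum // => c _.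
      exact: (dirichlet_neg P_stoch P_sym (fun x => f x b c)).
    - rewrite ler_wpM2l // -sumrN ler_sum // => a _; rewrite -sumrN ler_sum // => c _.
      exact: (dirichlet_neg P_stoch P_sym (fun y => f a y c)).
    - rewrite ler_wpM2l // -sumrN ler_sum // => a _; rewrite -sumrN ler_sum // => b _.
      exact: (dirichlet_neg P_stoch P_sym (f a b)).
  rewrite oppr_le0; apply: sumr_ge0 => a _; apply: sumr_ge0 => b _.
  apply: sumr_ge0 => c _; have [abc|abc] := boolP (bad a b c).
    by rewrite /g f_bad // oppr0 maxxx mul0r.
  by rewrite f_lap // mulr1 le_max lexx orbT.
by rewrite -oppr_le0 -g0 le_max lexx.
Qed.

Variables (h : S -> S -> R) (t : R).
Hypotheses (h_diag : forall x, h x x = 0) (h_sym : forall x z, h x z = h z x).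
Hypothesis h_sum : forall z, \sum_x h x z = #|S|%:R * t.
Hypothesis h_lap : forall x z, lap P (h^~ z) x = 1 - (x == z)%:R * #|S|%:R.

Let n : R := #|S|%:R.

(** Twice the Gromov product of [x] and [y] based at [z], with [h] as distance. *)
Definition gromov x y z := h x z + h y z - h x y.

Lemma gromov_bad x y z : bad x y z -> gromov x y z = 0.
Proof.
rewrite /gromov => /orP[] /eqP ->; rewrite h_diag ?(h_sym z x); last ring.
by rewrite (h_sym y z); ring.
Qed.

Lemma h_lapr x z : lap P (h x) z = 1 - (z == x)%:R * n.
Proof.
rewrite -h_lap; congr lap; apply/funext => y; exact: h_sym.
Qed.

Lemma gromov_lapz x y z :
  lap P (gromov x y) z = 2 - (z == x)%:R * n - (z == y)%:R * n.
Proof.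
have -> : gromov x y =
    (fun z => 1 * (1 * h x z + 1 * h y z) + (- h x y) * 1).
  by apply/funext => c; rewrite /gromov; ring.
by rewrite !(lap_lin P_stoch) !h_lapr (lap_cst P_stoch); ring.
Qed.

(** Off the diagonals every [h] has Laplacian 1 in each argument: the two terms met by a move of [x]
    or of [y] cancel, while the two met by a move of [z] add up to 2. *)
Lemma lap3_gromov x y z : ~~ bad x y z -> x != y ->
  lap3 gromov x y z = 2 * lamZ.
Proof.
rewrite negb_or => /andP[xz yz] xy; rewrite /lap3 gromov_lapz.
have -> : (fun x' => gromov x' y z) =
    (fun x' => 1 * (1 * h x' z + (-1) * h x' y) + h y z * 1).
  by apply/funext => c; rewrite /gromov; ring.
have -> : (fun y' => gromov x y' z) =
    (fun y' => 1 * (1 * h y' z + (-1) * h y' x) + h x z * 1).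
  by apply/funext => c; rewrite /gromov (h_sym x c); ring.
rewrite !(lap_lin P_stoch) !h_lap !(lap_cst P_stoch) !(eq_sym z) (eq_sym y x).
by rewrite (negbTE xz) (negbTE yz) (negbTE xy) /= !mul0r; ring.
Qed.

Lemma sum3_cst (a : R) : \sum_(x : S) \sum_(y : S) a = n ^+ 2 * a.
Proof.
under eq_bigr do rewrite sumr_const -[_ *+ _]mulr_natl.
by rewrite sumr_const -[_ *+ _]mulr_natl mulrA.
Qed.

Lemma sum_gromov : \sum_x \sum_y \sum_z gromov x y z = n ^+ 3 * t.
Proof.
have sum_hr x : \sum_z h x z = n * t.
  by rewrite -(h_sum x); apply: eq_bigr => z _.
under eq_bigr => x _.
  under eq_bigr => y _ do
    rewrite sumrB big_split /= !sum_hr sumr_const -[_ *+ _]mulr_natl.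
  rewrite sumrB -mulr_sumr sum_hr; over.
rewrite sumrB sum3_cst sumr_const -[_ *+ _]mulr_natl -/n; ring.
Qed.

(* The conductance is superadditive in the three speeds: [h x z], [h y z] and
   [gromov x y z] test the energies of [f] in the coordinates [x], [y] and [z]. *)
Lemma sum_exit_time_le f :
  (forall x y z, bad x y z -> f x y z = 0) ->
  (forall x y z, ~~ bad x y z -> lap3 f x y z = 1) ->
  \sum_x \sum_y \sum_z f x y z <= n ^+ 3 * t / (1 + lamY + 2 * lamZ).
Proof.
move=> f_bad f_lap; set F := \sum_x _; pose D := 1 + lamY + 2 * lamZ.
have D_gt0 : 0 < D by move: lamY_ge0 lamZ_ge0; rewrite /D; lra.
(* The lower bound below, [D (2 s F - s^2 n^3 t)], is largest at [s = F / (n^3 t)], which is [1/D]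
   when the claimed bound is an equality. *)
pose s := D^-1.
have FE : F = \sum_x \sum_y \sum_z f x y z * lap3 f x y z.
  apply: eq_bigr => x _; apply: eq_bigr => y _; apply: eq_bigr => z _.
  have [/f_bad ->|/f_lap ->] := boolP (bad x y z); first by rewrite mul0r.
  by rewrite mulr1.
have eX : 2 * s * F - s ^+ 2 * (n ^+ 3 * t) <=
    \sum_y \sum_z \sum_x f x y z * lap P (fun x' => f x' y z) x.
  have -> : 2 * s * F - s ^+ 2 * (n ^+ 3 * t) =
      \sum_y \sum_z (2 * s * (\sum_x f x y z) - s ^+ 2 * (n * t)).
    under [RHS]eq_bigr do rewrite sumrB.
    rewrite sumrB sum3_cst; congr (_ - _); last ring.
    under [RHS]eq_bigr do rewrite -mulr_sumr.
    rewrite -mulr_sumr; congr (_ * _); rewrite /F exchange_big.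
    by apply: eq_bigr => y _; exact: exchange_big.
  apply: ler_sum => y _; apply: ler_sum => z _.
  have := dirichlet_ge P_stoch P_sym s (fun x => f x y z) (h^~ z).
  (* The Laplacian of [h^~ z] differs from 1 only at [z], where both [f] and [h] vanish; so both
     pairings are plain sums. *)
  rewrite (eq_bigr (fun x => f x y z)) => [|x _]; last first.
    rewrite h_lap; have [->|_] := eqVneq x z; last by rewrite mul0r subr0 mulr1.
    by rewrite f_bad ?mul0r // /bad eqxx.
  rewrite [\sum_x h x z * _](eq_bigr (h^~ z)) ?h_sum // => x _.
  rewrite h_lap; have [->|_] := eqVneq x z; last by rewrite mul0r subr0 mulr1.
  by rewrite h_diag mul0r.
have eY : 2 * s * F - s ^+ 2 * (n ^+ 3 * t) <=
    \sum_x \sum_z \sum_y f x y z * lap P (fun y' => f x y' z) y.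
  have -> : 2 * s * F - s ^+ 2 * (n ^+ 3 * t) =
      \sum_x \sum_z (2 * s * (\sum_y f x y z) - s ^+ 2 * (n * t)).
    under [RHS]eq_bigr do rewrite sumrB.
    rewrite sumrB sum3_cst; congr (_ - _); last ring.
    under [RHS]eq_bigr do rewrite -mulr_sumr.
    rewrite -mulr_sumr; congr (_ * _); rewrite /F.
    by apply: eq_bigr => y _; exact: exchange_big.
  apply: ler_sum => x _; apply: ler_sum => z _.
  have := dirichlet_ge P_stoch P_sym s (fun y => f x y z) (h^~ z).
  rewrite (eq_bigr (fun y => f x y z)) => [|y _]; last first.
    rewrite h_lap; have [->|_] := eqVneq y z; last by rewrite mul0r subr0 mulr1.
    by rewrite f_bad ?mul0r // /bad eqxx orbT.
  rewrite [\sum_y h y z * _](eq_bigr (h^~ z)) ?h_sum // => y _.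
  rewrite h_lap; have [->|_] := eqVneq y z; last by rewrite mul0r subr0 mulr1.
  by rewrite h_diag mul0r.
(* In the coordinate [z] the test function has Laplacian 2 off the bad set, whence the weight 2 of
   [lamZ] in [D]. *)
have eZ : 2 * (2 * s * F - s ^+ 2 * (n ^+ 3 * t)) <=
    \sum_x \sum_y \sum_z f x y z * lap P (f x y) z.
  rewrite -sum_gromov.
  have -> : 2 * (2 * s * F - s ^+ 2 * (\sum_x \sum_y \sum_z gromov x y z)) =
      \sum_x \sum_y (2 * s * (2 * \sum_z f x y z)
                     - s ^+ 2 * (2 * \sum_z gromov x y z)).
    under [RHS]eq_bigr do rewrite sumrB -!mulr_sumr.
    by rewrite sumrB -!mulr_sumr -/F; ring.
  apply: ler_sum => x _; apply: ler_sum => y _.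
  have := dirichlet_ge P_stoch P_sym s (f x y) (gromov x y).
  have sumE (u : S -> S -> S -> R) : (forall x y z, bad x y z -> u x y z = 0) ->
      \sum_z u x y z * lap P (gromov x y) z = 2 * \sum_z u x y z.
    move=> u_bad; rewrite mulr_sumr; apply: eq_bigr => z _.
    have [/u_bad ->|] := boolP (bad x y z); first by rewrite mul0r mulr0.
    rewrite negb_or gromov_lapz !(eq_sym z) => /andP[/negbTE -> /negbTE ->].
    by rewrite !mul0r; ring.
  by rewrite !sumE //; exact: gromov_bad.
have : D * (2 * s * F - s ^+ 2 * (n ^+ 3 * t)) <= F.
  rewrite [leRHS]FE sum_lap3.
  have := ler_wpM2l lamY_ge0 eY; have := ler_wpM2l lamZ_ge0 eZ; rewrite /D; lra.
have -> : D * (2 * s * F - s ^+ 2 * (n ^+ 3 * t)) =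
  2 * (s * D) * F - (s * D) * (n ^+ 3 * t * s) by ring.
rewrite mulVf ?gt_eqF // -/D -/s; lra.
Qed.

End TripleWalk.

(** * The subharmonic potential *)

Lemma meeting_potential (R : realType) (S : finType) (P : S -> S -> R)
    (lamY lamZ : R) :
  (1 < #|S|)%N -> stochastic P -> irreducible P ->
  (forall x y, P x y = P y x) -> transitive_chain P ->
  0 <= lamY -> 0 <= lamZ ->
  exists (psi : S -> S -> S -> R) (theta : R),
  [/\ 0 < theta, forall x y z, bad x y z -> psi x y z = 0,
      forall x z, psi x x z <= 1,
      forall x y z, ~~ bad x y z -> x != y ->
        lap3 P lamY lamZ psi x y z = - theta &
      #|S|%:R ^+ 3 * (8^-1 / (1 + lamY + 2 * lamZ)) <=
        \sum_x \sum_y \sum_z psi x y z].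
Proof.
move=> S_gt1 P_stoch P_irr P_sym P_trans lamY_ge0 lamZ_ge0.
have [h [t [t_gt0 h_diag h_sym [h_le h_sum h_lap]]]] :=
  hitting_time P_stoch P_irr P_sym P_trans S_gt1.
have [f [f_bad f_lap f_ge0]] := exit_time P_stoch P_irr P_sym lamY_ge0 lamZ_ge0.
(* On [x = y] the product [gromov] is [2 h], at most [4 t], which fixes [k]. The excess 1/2 of [c]
   over [2 lamZ] gives the drift [k / 2]. The mean is at least [(1 - c / D) / 4], that is
   [(1/2 + lamY) / (4 D)]. *)
pose k := (4 * t)^-1; pose c := 2 * lamZ + 2^-1.
have k_gt0 : 0 < k by rewrite invr_gt0; lra.
have kt : k * t = 4^-1 by rewrite /k; field; rewrite gt_eqF.
pose psi x y z := k * gromov h x y z + (- (k * c)) * f x y z.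
exists psi, (k / 2); split.
- by rewrite divr_gt0.
- by move=> x y z xyz; rewrite /psi f_bad // (gromov_bad h_diag h_sym) // !mulr0 addr0.
- move=> x z; have kc : 0 <= k * c * f x x z.
    by rewrite !mulr_ge0 // /c; lra.
  have := ler_wpM2l (ltW k_gt0) (h_le x z); rewrite /psi /gromov h_diag; lra.
- move=> x y z xyz xy; rewrite (lap3_lin _ _ P_stoch).
  by rewrite (lap3_gromov _ _ P_stoch h_sym h_lap) // f_lap // /c; field.
have -> : \sum_x \sum_y \sum_z psi x y z =
    k * (#|S|%:R ^+ 3 * t) - k * c * (\sum_x \sum_y \sum_z f x y z).
  rewrite -(sum_gromov h_sym h_sum) !mulr_sumr -sumrB; apply: eq_bigr => x _.
  rewrite !mulr_sumr -sumrB; apply: eq_bigr => y _.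
  by rewrite !mulr_sumr -sumrB; apply: eq_bigr => z _; rewrite /psi mulNr.
have := sum_exit_time_le P_stoch P_sym lamY_ge0 lamZ_ge0 h_diag h_sym h_sum
  h_lap f_bad f_lap.
set F := (X in X <= _); set D := 1 + lamY + 2 * lamZ; set N := #|S|%:R ^+ 3.
have D_gt0 : 0 < D by rewrite /D; lra.
have N_ge0 : 0 <= N by rewrite exprn_ge0.
have kc_ge0 : 0 <= k * c by rewrite mulr_ge0 // /c; lra.
move=> /(ler_wpM2l kc_ge0).
have -> : k * c * (N * t / D) = 4^-1 * N * (c / D) by rewrite -kt; ring.
have -> : k * (N * t) = 4^-1 * N * (D / D).
  by rewrite divff ?gt_eqF // -kt; ring.
have : 0 <= N * ((lamY / D)) by rewrite mulr_ge0 // divr_ge0 // ltW.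
have -> : D / D = (1 + lamY + 2 * lamZ) * D^-1 by [].
rewrite -/F /c; move: D^-1 => i; lra.
Qed.

(** * Short-time behaviour of the heat kernel *)

Section Heat.
Variables (R : realType) (S : finType) (P : S -> S -> R).
Hypothesis P_stoch : stochastic P.

Lemma mpow_ge0 k x y : 0 <= mpow P k x y.
Proof.
elim: k y => [|k IH] y /=; first by case: ifP.
by apply: sumr_ge0 => z _; rewrite mulr_ge0 ?P_stoch.1.
Qed.

Lemma mpow_sum k x : \sum_y mpow P k x y = 1.
Proof.
elim: k => [|k IH] /=.
  by rewrite (bigD1 x) //= eqxx big1 ?addr0 // => y; rewrite eq_sym => /negbTE ->.
rewrite exchange_big /= -IH; apply: eq_bigr => z _.
by rewrite -mulr_sumr P_stoch.2 mulr1.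
Qed.

Lemma mpow1 x y : mpow P 1 x y = P x y.
Proof.
rewrite /= (bigD1 x) //= eqxx mul1r big1 ?addr0 // => z.
by rewrite eq_sym => /negbTE ->; rewrite mul0r.
Qed.

Lemma poisson_series (s : R) : 0 <= s ->
  (\sum_(k <oo) (expR (- s) * s ^+ k / k`!%:R)%:E = 1)%E.
Proof.
move=> s_ge0.
rewrite [RHS](_ : _ = (expR (- s))%:E * (expR s)%:E)%E; last first.
  by rewrite -EFinM expRN mulVf ?gt_eqF ?expR_gt0.
under eq_eseriesr do rewrite -mulrA EFinM.
rewrite nneseriesZl; last by move=> k _; rewrite lee_fin divr_ge0 // exprn_ge0.
congr (_ * _)%E; rewrite expRE -EFin_lim; last first.
  rewrite /pseries/=; under eq_fun do rewrite mulrC.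
  exact: is_cvg_series_exp_coeff.
apply/congr_lim/funext => n/=; rewrite /pseries/= /series/= -sumEFin//.
by under eq_bigr do rewrite mulrC.
Qed.

Variables (lam t : R).
Hypotheses (lam_ge0 : 0 <= lam) (t_ge0 : 0 <= t).
Let s := lam * t.

Let term x y k : R := expR (- s) * s ^+ k / k`!%:R * mpow P k x y.

Let s_ge0 : 0 <= s. Proof. exact: mulr_ge0. Qed.

Let weight_ge0 k : 0 <= expR (- s) * s ^+ k / k`!%:R.
Proof. by rewrite divr_ge0 // mulr_ge0 ?expR_ge0 // exprn_ge0. Qed.

Let term_ge0 x y k : (0 <= (term x y k)%:E)%E.
Proof. by rewrite lee_fin mulr_ge0 ?mpow_ge0. Qed.

Let heat_series x : (\sum_y \sum_(k <oo) (term x y k)%:E = 1)%E.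
Proof.
rewrite -nneseries_sum // -(poisson_series s_ge0).
apply: eq_eseriesr => k _; rewrite sumEFin.
by rewrite -mulr_sumr mpow_sum mulr1.
Qed.

(** The nonnegative series sum to 1 over [y], so each is finite and [fine] in [heat] never takes its
    default value. *)
Let heat_fin x y : (\sum_(k <oo) (term x y k)%:E)%E \is a fin_num.
Proof.
rewrite fin_numElt; apply/andP; split.
  by apply: (@lt_le_trans _ _ 0%E); [exact: ltNyr | exact: nneseries_ge0].
apply: (@le_lt_trans _ _ 1%E); last exact: ltry.
rewrite -(heat_series x) (bigD1 y) //= leeDl // sume_ge0 // => z _.
exact: nneseries_ge0.
Qed.

Lemma heat_sum x : \sum_y heat P lam t x y = 1.
Proof.
apply: EFin_inj; rewrite -(heat_series x) -sumEFin.
by apply: eq_bigr => y _; rewrite fineK //; exact: heat_fin.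
Qed.

(* No jump, or a single one. *)
Lemma heat_ge x y :
  expR (- (lam * t)) * ((x == y)%:R + lam * t * P x y) <= heat P lam t x y.
Proof.
rewrite -lee_fin fineK; last exact: heat_fin.
have := @nneseries_lim_ge R (fun k => (term x y k)%:E) xpredT 0 2
  (fun k _ _ => term_ge0 x y k).
apply: le_trans; rewrite big_nat_recr //= big_nat1 -EFinD lee_fin.
have -> : term x y 0 = expR (- s) * (x == y)%:R.
  by rewrite /term fact0 expr0 divr1 mulr1 /=; case: eqP.
have -> : term x y 1 = expR (- s) * (s * P x y).
  by rewrite /term mpow1 factS fact0 expr1 divr1 mulrA.
by rewrite -mulrDr.
Qed.

Lemma heat_ge0 x y : 0 <= heat P lam t x y.
Proof.
apply: le_trans _ (heat_ge x y).
by rewrite mulr_ge0 ?expR_ge0 // addr_ge0 // mulr_ge0 ?P_stoch.1.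
Qed.

End Heat.

(** * Discrete chains: reaching the good set before the bad one *)

Section Reach.
Variables (R : realType) (U : finType) (K : U -> U -> R).
Variables (is_bad is_good : pred U).

(** Badness is tested first, so a state both good and bad counts as bad; this matches the strict
    inequality between the meeting times. *)
Fixpoint reach k p : R :=
  if is_bad p then 0 else if is_good p then 1 else
  if k is k'.+1 then \sum_q K p q * reach k' q else 0.

Hypotheses (K_ge0 : forall p q, 0 <= K p q) (K_sum : forall p, \sum_q K p q = 1).

(** Along the chain [psi] gains at least [theta] per step until absorption. Being bounded, it cannot
    do so for long, so the contribution of unabsorbed paths disappears after finitely many steps. *)
Lemma reach_ge (psi : U -> R) (theta : R) : 0 < theta ->
  (forall p, is_bad p -> psi p <= 0) ->
  (forall p, is_good p -> psi p <= 1) ->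
  (forall p, ~~ is_bad p -> ~~ is_good p ->
    psi p + theta <= \sum_q K p q * psi q) ->
  exists k, forall p, psi p <= reach k p.
Proof.
move=> theta_gt0 psi_bad psi_good psi_step.
pose B := \sum_p `|psi p|.
have psi_le p : psi p <= B.
  by rewrite (le_trans (ler_norm _)) // /B (bigD1 p) //= lerDl sumr_ge0.
have B_ge0 : 0 <= B by exact: sumr_ge0.
(* The deficit allowed at horizon [k]: it starts at the bound [B], loses [theta] per step and stops
   at 0. *)
pose m (k : nat) := Num.max 0 (B - k%:R * theta).
have m_ge0 k : 0 <= m k by rewrite le_max lexx.
have reach_m k p : psi p - m k <= reach k p.
  elim: k p => [|k IH] p /=.
    case: ifPn => [/psi_bad|_]; first by have := m_ge0 0%N; lra.
    case: ifPn => [/psi_good|_]; first by have := m_ge0 0%N; lra.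
    rewrite subr_le0 (le_trans (psi_le p)) // /m mul0r subr0 le_max lexx.
    by rewrite orbT.
  have mk1 := m_ge0 k.+1.
  case: ifPn => [/psi_bad|pb]; first by lra.
  case: ifPn => [/psi_good|pg]; first by lra.
  apply: (@le_trans _ _ (\sum_q K p q * (psi q - m k))); last first.
    by apply: ler_sum => q _; rewrite ler_wpM2l.
  under [leRHS]eq_bigr do rewrite mulrBr.
  rewrite sumrB -mulr_suml K_sum mul1r.
  have := psi_step p pb pg.
  suff : m k - theta <= m k.+1 by lra.
  rewrite /m; case: (leP 0 (B - k%:R * theta)) => _; last first.
    by rewrite (@le_trans _ _ 0) ?le_max ?lexx //; lra.
  by rewrite le_max -natr1; apply/orP; right; lra.
exists (Num.bound (B / theta)) => p.
have : B / theta <= (Num.bound (B / theta))%:R.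
  by rewrite ltW // archi_boundP // divr_ge0 // ltW.
rewrite ler_pdivrMr // => Bk.
have := reach_m (Num.bound (B / theta)) p.
by rewrite /m max_l ?subr0 // subr_le0.
Qed.

End Reach.

(** * The triple sampled at multiples of a small time step *)

Section Skeleton.
Variables (R : realType) (S : finType) (P : S -> S -> R) (lamY lamZ : R).
Hypothesis P_stoch : stochastic P.
Hypotheses (lamY_ge0 : 0 <= lamY) (lamZ_ge0 : 0 <= lamZ).

Definition heat3 (dt : R) (p q : S * S * S) : R :=
  heat P 1 dt p.1.1 q.1.1 * heat P lamY dt p.1.2 q.1.2 * heat P lamZ dt p.2 q.2.

Lemma sum_triple (F : S * S * S -> R) :
  \sum_p F p = \sum_x \sum_y \sum_z F (x, y, z).
Proof.
rewrite pair_bigA pair_bigA; apply: eq_bigr; by case=> -[].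
Qed.

Variable dt : R.
Hypothesis dt_ge0 : 0 <= dt.

Lemma heat3_ge0 p q : 0 <= heat3 dt p q.
Proof. by rewrite !mulr_ge0 ?heat_ge0. Qed.

Lemma heat3_sum p : \sum_q heat3 dt p q = 1.
Proof.
rewrite sum_triple; rewrite -[RHS](heat_sum P_stoch ler01 dt_ge0 p.1.1).
apply: eq_bigr => x _.
rewrite -[RHS]mulr1 -[X in _ = _ * X](heat_sum P_stoch lamY_ge0 dt_ge0 p.1.2).
rewrite mulr_sumr; apply: eq_bigr => y _.
by rewrite /heat3 /= -mulr_sumr heat_sum // mulr1.
Qed.

Let s := (1 + lamY + lamZ) * dt.

Let jump1 (p q : S * S * S) : R :=
  let: (x, y, z) := p in let: (x', y', z') := q in
  expR (- s) *
   ((x == x')%:R * (y == y')%:R * (z == z')%:R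
    + dt * (P x x' * (y == y')%:R * (z == z')%:R
            + lamY * ((x == x')%:R * P y y' * (z == z')%:R)
            + lamZ * ((x == x')%:R * (y == y')%:R * P z z'))).

(** [jump1] keeps at most one jump among the three walkers: multiply the three bounds of [heat_ge]
    and drop the terms with two or three jumps, all nonnegative. *)
Let jump1_le p q : jump1 p q <= heat3 dt p q.
Proof.
case: p q => [[x y] z] [[x' y'] z'].
have hX := heat_ge P_stoch ler01 dt_ge0 x x'.
have hY := heat_ge P_stoch lamY_ge0 dt_ge0 y y'.
have hZ := heat_ge P_stoch lamZ_ge0 dt_ge0 z z'.
have pX := P_stoch.1 x x'; have pY := P_stoch.1 y y'; have pZ := P_stoch.1 z z'.
have term_ge0 (lam : R) (b : bool) (r : R) : 0 <= lam -> 0 <= r ->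
    0 <= expR (- (lam * dt)) * (b%:R + lam * dt * r).
  by move=> ? ?; rewrite mulr_ge0 ?expR_ge0 // addr_ge0 // !mulr_ge0.
rewrite /heat3 /=.
have hXY := ler_pM (term_ge0 1 (x == x') _ ler01 pX) (term_ge0 _ (y == y') _ lamY_ge0 pY) hX hY.
apply: le_trans _ (ler_pM _ (term_ge0 _ (z == z') _ lamZ_ge0 pZ) hXY hZ); last first.
  by rewrite mulr_ge0 ?term_ge0.
have -> : expR (- s) =
    expR (- (1 * dt)) * expR (- (lamY * dt)) * expR (- (lamZ * dt)).
  by rewrite -!expRD; congr expR; rewrite /s; ring.
set eX := expR _; set eY := expR _; set eZ := expR _.
have [a Ea] : exists a : R, (x == x')%:R = a by eexists.
have [b Eb] : exists b : R, (y == y')%:R = b by eexists.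
have [c Ec] : exists c : R, (z == z')%:R = c by eexists.
have a0 : 0 <= a by rewrite -Ea. have b0 : 0 <= b by rewrite -Eb.
have c0 : 0 <= c by rewrite -Ec.
rewrite Ea Eb Ec.
have -> : eX * (a + 1 * dt * P x x') * (eY * (b + lamY * dt * P y y')) *
    (eZ * (c + lamZ * dt * P z z')) = eX * eY * eZ *
    ((a + dt * P x x') * (b + dt * (lamY * P y y')) * (c + dt * (lamZ * P z z'))).
  by ring.
rewrite ler_pM2l ?mulr_gt0 ?expR_gt0 //.
have: 0 <= dt * P x x' by rewrite mulr_ge0.
have: 0 <= dt * (lamY * P y y') by rewrite !mulr_ge0.
have: 0 <= dt * (lamZ * P z z') by rewrite !mulr_ge0.
set u := dt * _; set v := dt * _; set w := dt * _ => w0 v0 u0.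
rewrite -subr_ge0.
have -> : (a + w) * (b + v) * (c + u) - (a * b * c + dt * (P x x' * b * c +
    lamY * (a * P y y' * c) + lamZ * (a * b * P z z'))) =
    w * v * c + w * b * u + a * v * u + w * v * u.
  by rewrite /u /v /w; ring.
by rewrite !addr_ge0 // !mulr_ge0.
Qed.

Let sum_delta (F : S -> R) x : \sum_x' (x == x')%:R * F x' = F x.
Proof.
rewrite (bigD1 x) //= eqxx mul1r big1 ?addr0 // => y.
by rewrite eq_sym => /negbTE ->; rewrite mul0r.
Qed.

Let sum_jump1 (f : S -> S -> S -> R) x y z :
  \sum_q jump1 (x, y, z) q * f q.1.1 q.1.2 q.2 =
  expR (- s) * ((1 + s) * f x y z - dt * lap3 P lamY lamZ f x y z).
Proof.
rewrite sum_triple /=.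
transitivity (\sum_x' \sum_y' \sum_z' expR (- s) *
   ((x == x')%:R * ((y == y')%:R * ((z == z')%:R * f x' y' z')) +
    dt * ((y == y')%:R * ((z == z')%:R * (P x x' * f x' y' z')) +
     lamY * ((x == x')%:R * ((z == z')%:R * (P y y' * f x' y' z'))) +
     lamZ * ((x == x')%:R * ((y == y')%:R * (P z z' * f x' y' z')))))).
  by do 3 (apply: eq_bigr => ? _); ring.
under eq_bigr do under eq_bigr do rewrite -mulr_sumr.
under eq_bigr do rewrite -mulr_sumr.
rewrite -mulr_sumr; congr (_ * _).
under eq_bigr => x' _.
  under eq_bigr => y' _ do rewrite big_split /= -!mulr_sumr sum_delta
    !big_split /= -!mulr_sumr !sum_delta.
  rewrite big_split /= -!mulr_sumr sum_delta !big_split /= -!mulr_sumr !sum_delta.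
  over.
rewrite big_split /= -!mulr_sumr sum_delta !big_split /= -!mulr_sumr !sum_delta.
rewrite /lap3 /lap /s; ring.
Qed.

(** The mass missing from [jump1] is [1 - e (1 + s)], at most [s^2]. It costs at most [B s^2] twice:
    once for the discarded jumps, once for replacing [e (1 + s) f] by [f]. *)
Lemma heat3_step (f : S -> S -> S -> R) (B : R) x y z :
  (forall x y z, `|f x y z| <= B) ->
  f x y z - expR (- s) * (dt * lap3 P lamY lamZ f x y z) - 2 * B * s ^+ 2 <=
  \sum_q heat3 dt (x, y, z) q * f q.1.1 q.1.2 q.2.
Proof.
move=> f_le; set e := expR (- s).
have s_ge0 : 0 <= s by rewrite mulr_ge0 // !addr_ge0.
have B_ge0 : 0 <= B by exact: le_trans (normr_ge0 _) (f_le x y z).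
have e_ge : 1 - s <= e by have := expR_ge1Dx (- s).
have e_le : e * (1 + s) <= 1.
  by rewrite -[leRHS](expRxMexpNx_1 s) mulrC ler_pM2r ?expR_gt0 // expR_ge1Dx.
have mass : \sum_q jump1 (x, y, z) q = e * (1 + s).
  have := sum_jump1 (fun _ _ _ => 1) x y z.
  under eq_bigr do rewrite mulr1.
  by move=> ->; rewrite /lap3 !(lap_cst P_stoch) !mulr0 !addr0 mulr0 subr0 mulr1.
have rest : - B * (1 - e * (1 + s)) <=
    \sum_q (heat3 dt (x, y, z) q - jump1 (x, y, z) q) * f q.1.1 q.1.2 q.2.
  rewrite -mass -(heat3_sum (x, y, z)) -sumrB mulr_sumr; apply: ler_sum => q _.
  rewrite mulrC ler_wpM2l ?subr_ge0 //.
  by have := f_le q.1.1 q.1.2 q.2; rewrite ler_norml => /andP[].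
have -> : \sum_q heat3 dt (x, y, z) q * f q.1.1 q.1.2 q.2 =
    \sum_q jump1 (x, y, z) q * f q.1.1 q.1.2 q.2 +
    \sum_q (heat3 dt (x, y, z) q - jump1 (x, y, z) q) * f q.1.1 q.1.2 q.2.
  by rewrite -big_split; apply: eq_bigr => q _ /=; ring.
rewrite sum_jump1 -/e.
have fB : f x y z <= B by exact: le_trans (ler_norm _) (f_le x y z).
have defect : 1 - e * (1 + s) <= s ^+ 2.
  have := ler_wpM2r (addr_ge0 ler01 s_ge0) e_ge; rewrite expr2; lra.
have := ler_wpM2l B_ge0 defect.
have : (1 - e * (1 + s)) * f x y z <= (1 - e * (1 + s)) * B.
  by rewrite ler_wpM2l // subr_ge0.
move: rest; lra.
Qed.

End Skeleton.

Definition bad_state (S : finType) (p : S * S * S) := bad p.1.1 p.1.2 p.2.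
Definition good_state (S : finType) (p : S * S * S) := p.1.1 == p.1.2.

Lemma skeleton_reach (R : realType) (S : finType) (P : S -> S -> R)
    (lamY lamZ : R) :
  (1 < #|S|)%N -> stochastic P -> irreducible P ->
  (forall x y, P x y = P y x) -> transitive_chain P ->
  0 <= lamY -> 0 <= lamZ ->
  exists2 dt0 : R, 0 < dt0 & forall dt, 0 < dt -> dt <= dt0 -> exists k,
    #|S|%:R ^+ 3 * (8^-1 / (1 + lamY + 2 * lamZ)) <=
    \sum_p reach (heat3 P lamY lamZ dt) (@bad_state S) (@good_state S) k p.
Proof.
move=> S_gt1 P_stoch P_irr P_sym P_trans lamY_ge0 lamZ_ge0.
have [psi [theta [theta_gt0 psi_bad psi_good psi_lap psi_sum]]] :=
  meeting_potential S_gt1 P_stoch P_irr P_sym P_trans lamY_ge0 lamZ_ge0.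
pose B := \sum_x \sum_y \sum_z `|psi x y z|.
have psi_le x y z : `|psi x y z| <= B.
  rewrite /B (bigD1 x) //= (bigD1 y) //= (bigD1 z) //= -!addrA lerDl.
  rewrite !addr_ge0 ?sumr_ge0 // => ? _; rewrite ?sumr_ge0 // => ? _.
  by rewrite sumr_ge0.
have B_ge0 : 0 <= B by do 3 (apply: sumr_ge0 => ? _).
pose L := 1 + lamY + lamZ.
have L_gt0 : 0 < L by rewrite /L; lra.
(* With [s = L dt], the losses [s dt theta] and [2 B s^2] add up to [A dt^2]. For [dt] at most
   [theta / (2 A)] they use up at most half of the drift [dt theta]. *)
pose A := L * theta + 2 * B * L ^+ 2.
have A_gt0 : 0 < A.
  have := mulr_gt0 L_gt0 theta_gt0.
  have : 0 <= 2 * B * L ^+ 2 by rewrite mulr_ge0 ?sqr_ge0 // mulr_ge0.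
  rewrite /A; lra.
exists (theta / (2 * A)) => [|dt dt_gt0]; first by rewrite divr_gt0 ?mulr_gt0.
rewrite ler_pdivlMr ?mulr_gt0 // => dt_le.
have dt_ge0 := ltW dt_gt0.
have [|p pbad|p pgood|[[x y] z] pbad pgood|k psi_reach] :=
    @reach_ge R _ (heat3 P lamY lamZ dt) (@bad_state S) (@good_state S)
      (heat3_ge0 P_stoch lamY_ge0 lamZ_ge0 dt_ge0)
      (heat3_sum P_stoch lamY_ge0 lamZ_ge0 dt_ge0)
      (fun p => psi p.1.1 p.1.2 p.2) (dt * theta / 2).
- by rewrite divr_gt0 ?mulr_gt0.
- by rewrite psi_bad.
- by rewrite -(eqP pgood) psi_good.
- apply: le_trans _ (heat3_step P_stoch lamY_ge0 lamZ_ge0 dt_ge0 x y z psi_le).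
  rewrite /= psi_lap //; set s := (1 + lamY + lamZ) * dt.
  have e_ge : 1 - s <= expR (- s) by have := expR_ge1Dx (- s).
  have dtheta : 0 <= dt * theta by rewrite mulr_ge0 // ltW.
  have := ler_wpM2r dtheta e_ge.
  have := ler_wpM2l dt_ge0 dt_le.
  rewrite (_ : dt * (dt * (2 * A)) = 2 * (s * (dt * theta)) + 4 * B * s ^+ 2); last first.
    by rewrite /s /A /L; ring.
  lra.
exists k; apply: le_trans psi_sum _.
rewrite -(sum_triple (fun p => psi p.1.1 p.1.2 p.2)).
exact: ler_sum.
Qed.

(** * Hitting probabilities along a skeleton *)

Section Reaches.
Variables (U : Type) (is_bad is_good : pred U).

Fixpoint reaches (v : nat -> U) j k : bool :=
  if is_bad (v j) then false else if is_good (v j) then true else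
  if k is k'.+1 then reaches v j.+1 k' else false.

Lemma reachesP v :
  (exists k, reaches v 0 k) <->
  exists2 i, is_good (v i) & forall l, (l <= i)%N -> ~~ is_bad (v l).
Proof.
split=> [[k]|[i gi nbad]].
  suff H j : reaches v j k -> exists2 i, is_good (v (j + i)%N) &
      forall l, (l <= i)%N -> ~~ is_bad (v (j + l)%N).
    by move=> /H.
  elim: k j => [|k IH] j /=.
    case: ifPn => // bj; case: ifPn => // gj _; exists 0%N; rewrite ?addn0 //.
    by move=> l; rewrite leqn0 => /eqP ->; rewrite addn0.
  case: ifPn => // bj; case: ifPn => [gj _|_ /IH[i gi nbad]].
    exists 0%N; rewrite ?addn0 //.
    by move=> l; rewrite leqn0 => /eqP ->; rewrite addn0.
  exists i.+1; first by rewrite -addSnnS.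
  by case=> [_|l li]; [rewrite addn0 | rewrite -addSnnS nbad].
exists i; suff H j : is_good (v (j + i)%N) ->
    (forall l, (l <= i)%N -> ~~ is_bad (v (j + l)%N)) -> reaches v j i.
  exact: H.
elim: i j {gi nbad} => [|i IH] j gi nbad /=.
  by rewrite -[j]addn0 (negbTE (nbad _ _)) // gi.
rewrite -{1}[j]addn0 (negbTE (nbad _ _)) //; case: ifP => // _.
apply: IH => [|l li]; first by rewrite addSnnS.
by rewrite addSnnS nbad.
Qed.

End Reaches.

Section ChainProbability.
Context {d : measure_display} {T : measurableType d} {R : realType}.
Variables (Pr : probability T R) (U : finType) (V : nat -> T -> U).
Variables (mu0 : U -> R) (K : U -> U -> R) (is_bad is_good : pred U).

Definition cylinder (us : nat -> U) n : set T :=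
  [set w | forall i, (i <= n)%N -> V i w = us i].

Hypothesis V_meas : forall i u, measurable [set w | V i w = u].
Hypothesis V_law : forall us n,
  Pr (cylinder us n) = (mu0 (us 0) * \prod_(i < n) K (us i) (us i.+1))%:E.

Let hits j k : set T := [set w | reaches is_bad is_good (V^~ w) j k].

Lemma measurable_preimage_fin i (Q : pred U) : measurable [set w | Q (V i w)].
Proof.
have -> : [set w | Q (V i w)] = \bigcup_(u in [set u | Q u]) [set w | V i w = u].
  apply/seteqP; split=> [w Qw|w [u /= Qu Vu]]; first by exists (V i w).
  by rewrite /= Vu.
by apply: fin_bigcup_measurable => //; exact: finite_finset.
Qed.

Lemma measurable_hits j k : measurable (hits j k).
Proof.
elim: k j => [|k IH] j.
  have -> : hits j 0 = [set w | ~~ is_bad (V j w) && is_good (V j w)].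
    apply/seteqP; split=> w; rewrite /hits /=; case: ifP => //; case: ifP => //.
  exact: (@measurable_preimage_fin j (fun u => ~~ is_bad u && is_good u)).
have -> : hits j k.+1 = [set w | ~~ is_bad (V j w) && is_good (V j w)] `|`
    ([set w | ~~ is_bad (V j w)] `&` hits j.+1 k).
  apply/seteqP; split=> w; rewrite /hits /=.
    case: ifPn => // bj; case: ifPn => [gj _|_ ?]; [by left|by right].
  by case=> [/andP[/negbTE -> ->//]|[/negbTE -> ->]]; case: ifP.
apply: measurableU; last apply: measurableI => //.
  exact: (@measurable_preimage_fin j (fun u => ~~ is_bad u && is_good u)).
exact: (@measurable_preimage_fin j (fun u => ~~ is_bad u)).
Qed.

Lemma measurable_cylinder us n : measurable (cylinder us n).
Proof.
have -> : cylinder us n = \bigcap_(i in `I_n.+1) [set w | V i w = us i] by [].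
by apply: bigcap_measurable => //; exists 0%N.
Qed.

Lemma measure_split i (A : set T) : measurable A ->
  Pr A = (\sum_(u : U) Pr (A `&` [set w | V i w = u]))%E.
Proof.
move=> mA; rewrite -big_enum fsbig_seq ?enum_uniq //=.
rewrite (_ : [set` enum U] = setT); last first.
  by apply/seteqP; split=> u //= _; rewrite mem_enum.
rewrite -measure_fin_bigcup //.
- congr (Pr _); apply/seteqP; split=> [w Aw|w [u _ []//]].
  by exists (V i w).
- exact: finite_finset.
- by move=> u v _ _ [w [[_ <-] [_ <-]]].
- by move=> u _; exact: measurableI.
Qed.

(** Markov property by induction on the horizon: unless the state at time [n] already decides, split
    according to the state at time [n + 1], which lengthens the cylinder by one. *)
Lemma prob_cylinder_hits k us n :
  Pr (cylinder us n `&` hits n k) =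
  (mu0 (us 0) * \prod_(i < n) K (us i) (us i.+1)
   * reach K is_bad is_good k (us n))%:E.
Proof.
elim: k us n => [|k IH] us n /=.
  case: ifPn => [b|nb]; last case: ifPn => [g|ng].
  - rewrite mulr0 (_ : _ `&` _ = set0) ?measure0 //.
    by apply/seteqP; split=> // w [/(_ n (leqnn n)) Vn]; rewrite /hits /= Vn b.
  - rewrite mulr1 -V_law; congr (Pr _); apply/seteqP; split=> [w []//|w cw].
    by split=> //; rewrite /hits /= (cw n) // (negbTE nb) g.
  - rewrite mulr0 (_ : _ `&` _ = set0) ?measure0 //.
    apply/seteqP; split=> // w [/(_ n (leqnn n)) Vn]; rewrite /hits /= Vn.
    by rewrite (negbTE nb) (negbTE ng).
case: ifPn => [b|nb]; last case: ifPn => [g|ng].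
- rewrite mulr0 (_ : _ `&` _ = set0) ?measure0 //.
  by apply/seteqP; split=> // w [/(_ n (leqnn n)) Vn]; rewrite /hits /= Vn b.
- rewrite mulr1 -V_law; congr (Pr _); apply/seteqP; split=> [w []//|w cw].
  by split=> //; rewrite /hits /= (cw n) // (negbTE nb) g.
rewrite (measure_split n.+1); last first.
  by apply: measurableI; [exact: measurable_cylinder | exact: measurable_hits].
rewrite mulr_sumr -sumEFin; apply: eq_bigr => u _.
pose us' i := if i == n.+1 then u else us i.
have us'E i : (i <= n)%N -> us' i = us i by rewrite -ltnS /us' => /ltn_eqF ->.
have us'S : us' n.+1 = u by rewrite /us' eqxx.
have -> : cylinder us n `&` hits n k.+1 `&` [set w | V n.+1 w = u] =
    cylinder us' n.+1 `&` hits n.+1 k.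
  apply/seteqP; split=> [w [[cw hw] /= Vu]|w [cw hw]].
    split=> [i|].
      rewrite leq_eqVlt ltnS => /orP[/eqP ->|i_n]; first by rewrite us'S.
      by rewrite us'E // cw.
    by move: hw; rewrite /hits /= (cw n) // (negbTE nb) (negbTE ng).
  split; last by rewrite /= cw.
  split=> [i i_n|]; first by rewrite cw ?us'E // leqW.
  by rewrite /hits /= (cw n) // us'E // (negbTE nb) (negbTE ng).
rewrite IH big_ord_recr /= us'S !us'E // -!mulrA; congr (_ * (_ * _))%:E.
by apply: eq_bigr => i _; rewrite !us'E // ltnW.
Qed.

Lemma prob_hits k :
  Pr (hits 0 k) = (\sum_u mu0 u * reach K is_bad is_good k u)%:E.
Proof.
rewrite (measure_split 0); last exact: measurable_hits.
rewrite -sumEFin; apply: eq_bigr => u _.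
have := prob_cylinder_hits k (fun=> u) 0; rewrite big_ord0 mulr1 => <-.
congr (Pr _); rewrite setIC; congr (_ `&` _).
apply/seteqP; split=> w /=; last exact.
by move=> Vu i; rewrite leqn0 => /eqP ->.
Qed.

Lemma prob_ex_hits k :
  ((\sum_u mu0 u * reach K is_bad is_good k u)%:E <=
   Pr [set w | exists k, reaches is_bad is_good (V^~ w) 0 k])%E.
Proof.
rewrite -prob_hits; apply: le_measure; rewrite ?inE.
- exact: measurable_hits.
- rewrite [X in measurable X](_ : _ = \bigcup_k hits 0 k).
    by apply: bigcup_measurable => l _; exact: measurable_hits.
  by apply/seteqP; split=> w [l]; [exists l | move=> _ ?; exists l].
- by move=> w hw; exists k.
Qed.

Lemma measurable_ex_hits :
  measurable [set w | exists k, reaches is_bad is_good (V^~ w) 0 k].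
Proof.
rewrite [X in measurable X](_ : _ = \bigcup_k hits 0 k).
  by apply: bigcup_measurable => l _; exact: measurable_hits.
by apply/seteqP; split=> w [l]; [exists l | move=> _ ?; exists l].
Qed.

End ChainProbability.

(** * Meeting times of right-continuous paths *)

Lemma first_multiple (R : realType) (dt t : R) : 0 < dt -> 0 <= t ->
  exists i : nat, [/\ t <= i%:R * dt, i%:R * dt < t + dt &
    forall j : nat, t <= j%:R * dt -> (i <= j)%N].
Proof.
move=> dt_gt0 t_ge0.
have ex : exists i : nat, t <= i%:R * dt.
  exists (Num.bound (t / dt)); rewrite -ler_pdivrMr // ltW //.
  by rewrite archi_boundP // divr_ge0 // ltW.
case: (ex_minnP ex) => i ti imin; exists i; split=> //.
case: i ti imin => [|i] ti imin; first by rewrite mul0r; lra.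
have : i%:R * dt < t by rewrite ltNge; apply/negP => /imin; rewrite ltnn.
rewrite -natr1 mulrDl mul1r; lra.
Qed.

Section MeetTime.
Variables (R : realType) (S : finType) (a b : R -> S).
Hypotheses (ra : right_cont_path a) (rb : right_cont_path b).

Lemma meet_time_le t : 0 <= t -> a t = b t -> (meet_time a b <= t%:E)%E.
Proof. by move=> t_ge0 ab; apply: ereal_inf_lbound; exists t. Qed.

(** If the paths differed at the infimum, right-continuity would keep them apart for a while after
    it, contradicting the infimum. *)
Lemma meet_time_attained : (meet_time a b < +oo)%E ->
  exists2 t, 0 <= t /\ a t = b t & meet_time a b = t%:E.
Proof.
move=> fin.
have ge0 : (0 <= meet_time a b)%E.
  by apply: le_ereal_inf_tmp => _ [t [t_ge0 _] <-]; rewrite lee_fin.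
have [t Et] : exists t, meet_time a b = t%:E.
  by exists (fine (meet_time a b)); rewrite fineK // ge0_fin_numE.
exists t => //; have t_ge0 : 0 <= t by rewrite -lee_fin -Et.
split=> //; have [//|ab] := eqVneq (a t) (b t).
have [e e_gt0 ae] := ra t_ge0; have [e' e'_gt0 be] := rb t_ge0.
suff : ((t + Num.min e e')%:E <= meet_time a b)%E.
  by rewrite Et lee_fin gerDl leNgt lt_min e_gt0 e'_gt0.
apply: le_ereal_inf_tmp => _ [s [s_ge0 abs] <-]; rewrite lee_fin leNgt.
apply/negP => s_lt; case/eqP: ab.
have ts : t <= s by rewrite -lee_fin -Et meet_time_le.
have [se se'] : s < t + e /\ s < t + e'.
  by apply/andP; rewrite -!ltrBlDl -lt_min ltrBlDl.
by rewrite -(ae s) // -(be s).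
Qed.

End MeetTime.

(** * Comparison of continuous paths with their skeletons *)

Definition mesh (R : realType) (m : nat) : R := m.+1%:R^-1.

Lemma mesh_gt0 (R : realType) m : 0 < mesh R m.
Proof. by rewrite invr_gt0. Qed.

Lemma mesh_small (R : realType) (e : R) : 0 < e ->
  exists N, forall m, (N <= m)%N -> mesh R m < e.
Proof.
move=> e_gt0; exists (Num.bound e^-1) => m Nm.
rewrite -[ltRHS]invrK ltf_pV2 ?posrE ?invr_gt0 //.
apply: lt_le_trans (archi_boundP _) _; first by rewrite invr_ge0 ltW.
by rewrite ler_nat ltnW.
Qed.

Section Paths.
Variables (R : realType) (S : finType) (x y z : R -> S).
Hypotheses (rx : right_cont_path x) (ry : right_cont_path y)
  (rz : right_cont_path z).

Definition skeleton m (i : nat) : S * S * S :=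
  (x (i%:R * mesh R m), y (i%:R * mesh R m), z (i%:R * mesh R m)).

Definition skeleton_hits m : Prop :=
  exists k, reaches (@bad_state S) (@good_state S) (skeleton m) 0 k.

Lemma common_right_cont t : 0 <= t -> exists2 e, 0 < e &
  forall s, t <= s -> s < t + e -> [/\ x s = x t, y s = y t & z s = z t].
Proof.
move=> t_ge0.
have [e1 e1_gt0 h1] := rx t_ge0; have [e2 e2_gt0 h2] := ry t_ge0.
have [e3 e3_gt0 h3] := rz t_ge0.
exists (Num.min e1 (Num.min e2 e3)) => [|s ts].
  by rewrite !lt_min e1_gt0 e2_gt0.
rewrite -ltrBlDl !lt_min !ltrBlDl => /and3P[s1 s2 s3].
by split; [exact: h1 | exact: h2 | exact: h3].
Qed.

(** By right-continuity, the state at a meeting time persists long enough to be seen by every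
    sufficiently fine grid. *)
Lemma good_first_skeleton :
  (meet_time x y < Order.min (meet_time x z) (meet_time y z))%E <->
  forall n, exists2 m, (n <= m)%N & skeleton_hits m.
Proof.
split=> [|hits].
  rewrite lt_min => /andP[xy_xz xy_yz] n.
  have [t [t_ge0 xyt] Et] := meet_time_attained rx ry (lt_le_trans xy_xz (leey _)).
  have [e e_gt0 cst] := common_right_cont t_ge0.
  have [N meshN] := mesh_small e_gt0.
  exists (maxn n N); first exact: leq_maxl.
  have mesh_lt := meshN _ (leq_maxr n N).
  have [i [ti it _]] := first_multiple (mesh_gt0 R (maxn n N)) t_ge0.
  have not_bad s : 0 <= s -> s <= t -> ~~ bad (x s) (y s) (z s).
    move=> s_ge0 st; apply/negP => /orP[/eqP xz|/eqP yz].
      move: xy_xz; rewrite Et ltNge => /negP; apply.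
      by rewrite (le_trans (meet_time_le s_ge0 xz)) // lee_fin.
    move: xy_yz; rewrite Et ltNge => /negP; apply.
    by rewrite (le_trans (meet_time_le s_ge0 yz)) // lee_fin.
  apply/reachesP; exists i; rewrite /good_state /bad_state /=.
    have [|-> -> _] := cst _ ti; first by lra.
    exact/eqP.
  move=> l li; set s := l%:R * _.
  have s_ge0 : 0 <= s by rewrite mulr_ge0 // ltW // mesh_gt0.
  (* Grid times up to [t] precede any bad meeting; the later ones, up to index [i], still show the
     state at [t]. *)
  have [st|/ltW ts] := leP s t; first exact: not_bad.
  have s_le : s <= i%:R * mesh R (maxn n N).
    by rewrite ler_wpM2r ?ler_nat // ltW // mesh_gt0.
  by have [|-> -> ->] := cst _ ts; [lra | exact: not_bad].
rewrite ltNge; apply/negP => min_le.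
have good_le m i : good_state (skeleton m i) ->
    (meet_time x y <= (i%:R * mesh R m)%:E)%E.
  move=> /eqP; apply: meet_time_le.
  by rewrite mulr_ge0 // ltW // mesh_gt0.
have xy_fin : (meet_time x y < +oo)%E.
  have [m _ /reachesP[i gi _]] := hits 0%N.
  exact: le_lt_trans (good_le _ _ gi) (ltry _).
have [t [t_ge0 bad_t] t_le] : exists2 t, 0 <= t /\ bad (x t) (y t) (z t) &
    (t%:E <= meet_time x y)%E.
  move: min_le; rewrite ge_min => /orP[] le_xy.
    have [t [? xz] Et] := meet_time_attained rx rz (le_lt_trans le_xy xy_fin).
    by exists t; rewrite -?Et // /bad xz eqxx.
  have [t [? yz] Et] := meet_time_attained ry rz (le_lt_trans le_xy xy_fin).
  by exists t; rewrite -?Et // /bad yz eqxx orbT.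
have [e e_gt0 cst] := common_right_cont t_ge0.
have [N meshN] := mesh_small e_gt0.
have [m Nm /reachesP[i gi nbad]] := hits N.
(* The first grid time after the bad meeting still shows a bad state, and no good grid time comes
   earlier. *)
have [j [tj jt jmin]] := first_multiple (mesh_gt0 R m) t_ge0.
have ji : (j <= i)%N.
  by apply: jmin; rewrite -lee_fin (le_trans t_le) // good_le.
have /negP := nbad _ ji; apply; rewrite /bad_state /=.
have [|-> -> -> //] := cst _ tj.
by apply: lt_trans jt _; rewrite ltrD2l meshN.
Qed.

End Paths.

(** * From the skeletons to the continuous-time event *)

Theorem theorem1p2 (R : realType) :
  exists c : R, 0 < c /\
  forall (S : finType) (P : S -> S -> R) (pi : S -> R) (lamY lamZ : R)
    (d : measure_display) (T : measurableType d) (Pr : probability T R)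
    (X Y Z : R -> T -> S),
    (1 < #|S|)%N ->
    stochastic P -> irreducible P -> stationary P pi -> reversible P pi ->
    transitive_chain P ->
    0 <= lamY -> lamY <= 1 -> 0 <= lamZ ->
    (forall t x, measurable [set w | X t w = x]) ->
    (forall t x, measurable [set w | Y t w = x]) ->
    (forall t x, measurable [set w | Z t w = x]) ->
    (forall w, right_cont_path (fun t => X t w)) ->
    (forall w, right_cont_path (fun t => Y t w)) ->
    (forall w, right_cont_path (fun t => Z t w)) ->
    (* joint finite-dimensional laws: X, Y, Z independent Markov chains with
       matrix P, speeds 1, lamY, lamZ, started from pi *)
    (forall (n : nat) (ts : nat -> R) (xs ys zs : nat -> S),
       ts 0%N = 0 -> (forall i, (i < n)%N -> ts i <= ts i.+1) ->
       Pr [set w | forall i, (i <= n)%N ->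
                     X (ts i) w = xs i /\ Y (ts i) w = ys i /\ Z (ts i) w = zs i]
       = (path_prob P pi 1 n ts xs * path_prob P pi lamY n ts ys
          * path_prob P pi lamZ n ts zs)%:E) ->
    ((c / (Num.sqrt (1 + lamZ) + Num.sqrt (lamY + lamZ)) ^+ 2)%:E <=
     Pr [set w | (meet_time (fun t => X t w) (fun t => Y t w) <
                  Order.min (meet_time (fun t => X t w) (fun t => Z t w))
                            (meet_time (fun t => Y t w) (fun t => Z t w)))%E])%E.
Proof.
exists 8^-1; split; first by rewrite invr_gt0.
move=> S P pi lamY lamZ d T Pr X Y Z S_gt1 P_stoch P_irr pi_stat P_rev P_trans.
move=> lamY_ge0 _ lamZ_ge0 mX mY mZ rX rY rZ law.
have pi_unif := stationary_uniform P_stoch P_irr pi_stat P_rev P_trans.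
have P_sym := transitive_symmetric P_stoch P_irr pi_stat P_rev P_trans.
have [dt0 dt0_gt0 reach_sum] :=
  skeleton_reach S_gt1 P_stoch P_irr P_sym P_trans lamY_ge0 lamZ_ge0.
pose D := 1 + lamY + 2 * lamZ.
have D_gt0 : 0 < D by rewrite /D; lra.
pose c := 8^-1 / D.
have c_ge : 8^-1 / (Num.sqrt (1 + lamZ) + Num.sqrt (lamY + lamZ)) ^+ 2 <= c.
  have a_ge0 : 0 <= 1 + lamZ by lra.
  have b_ge0 : 0 <= lamY + lamZ by lra.
  (* Expanding the square gives [D] plus twice the product of the roots. *)
  have D_le : D <= (Num.sqrt (1 + lamZ) + Num.sqrt (lamY + lamZ)) ^+ 2.
    rewrite sqrrD !sqr_sqrtr //.
    have : 0 <= Num.sqrt (1 + lamZ) * Num.sqrt (lamY + lamZ) by rewrite mulr_ge0.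
    rewrite /D; lra.
  by rewrite ler_pM2l ?invr_gt0 // lef_pV2 ?posrE // (lt_le_trans D_gt0).
apply: (@le_trans _ _ c%:E); first by rewrite lee_fin.
pose V m i w := skeleton (X^~ w) (Y^~ w) (Z^~ w) m i.
pose F m : set T := [set w | skeleton_hits (X^~ w) (Y^~ w) (Z^~ w) m].
have V_meas m i u : measurable [set w | V m i w = u].
  case: u => [[x y] z]; set s := i%:R * mesh R m.
  have -> : [set w | V m i w = (x, y, z)] =
      [set w | X s w = x] `&` [set w | Y s w = y] `&` [set w | Z s w = z].
    by apply/seteqP; split=> [w [<- <- <-]|w [[/= <- <-] <-]].
  by apply: measurableI => //; exact: measurableI.
pose mu0 (p : S * S * S) := pi p.1.1 * pi p.1.2 * pi p.2.
have V_law m us n : Pr (cylinder (V m) us n) =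
    (mu0 (us 0) * \prod_(i < n) heat3 P lamY lamZ (mesh R m) (us i) (us i.+1))%:E.
  have -> : cylinder (V m) us n = [set w | forall i, (i <= n)%N ->
      X (i%:R * mesh R m) w = (us i).1.1 /\ Y (i%:R * mesh R m) w = (us i).1.2 /\
      Z (i%:R * mesh R m) w = (us i).2].
    apply/seteqP; split=> w cw i i_n; first by rewrite -cw.
    have [x_i [y_i z_i]] := cw i i_n.
    by rewrite /V /skeleton x_i y_i z_i; case: (us i) => -[].
  rewrite (law n (fun i => i%:R * mesh R m) (fun i => (us i).1.1)
    (fun i => (us i).1.2) (fun i => (us i).2)); first last.
  - by move=> i _; rewrite ler_wpM2r ?ler_nat // ltW // mesh_gt0.
  - by rewrite mul0r.
  have incr (i : nat) : i.+1%:R * mesh R m - i%:R * mesh R m = mesh R m.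
    by rewrite -natr1; ring.
  rewrite /path_prob; under eq_bigr do rewrite incr.
  under [X in _ * (pi _ * X) * _]eq_bigr do rewrite incr.
  under [X in _ * (pi _ * X)]eq_bigr do rewrite incr.
  rewrite /heat3 !big_split /= /mu0; congr _%:E; ring.
have F_meas m : measurable (F m) by exact: measurable_ex_hits (V_meas m).
have F_ge m : mesh R m <= dt0 -> (c%:E <= Pr (F m))%E.
  move=> /(reach_sum _ (mesh_gt0 R m))[k reach_k].
  have := prob_ex_hits (@bad_state S) (@good_state S) (V_meas m) (V_law m) k.
  apply: le_trans.
  have n_gt0 : 0 < #|S|%:R :> R by rewrite ltr0n ltnW.
  (* The initial law is uniform on triples, and its weight [n^-3] cancels the factor [n^3] of the
     lower bound. *)
  rewrite lee_fin /mu0; under eq_bigr do rewrite !pi_unif.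
  rewrite -mulr_sumr -!invfM -!expr2 -exprSr mulrC ler_pdivlMr ?exprn_gt0 //.
  by rewrite mulrC.
rewrite (_ : [set w | _] = lim_sup_set F); last first.
  apply/seteqP; split=> [w /(good_first_skeleton (rX w) (rY w) (rZ w)) hw n _|w hw].
    by have [m nm Fm] := hw n; exists m.
  apply/(good_first_skeleton (rX w) (rY w) (rZ w)) => n.
  by have [m /= nm Fm] := hw n I; exists m.
have [N meshN] := mesh_small dt0_gt0.
have F_fin : (Pr (\bigcup_(k >= 0) F k) < +oo)%E.
  apply: le_lt_trans (probability_le1 Pr _) (ltry _).
  by apply: bigcup_measurable.
(* The probability of the limit superior is the limit of those of the tail unions, each of which
   contains some [F m] with [m >= N]. *)
have /cvg_lim <- // := lim_sup_set_cvg Pr F F_meas F_fin.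
apply: lime_ge.
  by apply/cvg_ex; eexists; exact: lim_sup_set_cvg Pr F F_meas F_fin.
apply: nearW => n; apply: le_trans (F_ge (maxn n N) _) _.
  by rewrite ltW // meshN // leq_maxr.
apply: le_measure; rewrite ?inE //; first exact: bigcup_measurable.
by move=> w Fw; exists (maxn n N) => //=; exact: leq_maxl.
Qed.
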